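(* Let $V$ be a Hilbert space with norm $\|\cdot\|_V$. Let $a:V\times V\to\mathbb{R}$ be a symmetric bilinear form that is continuous and coercive, i.e. there are constants $M,\alpha>0$ with $|a(w,v)|\le M\|w\|_V\|v\|_V$ and $a(v,v)\ge\alpha\|v\|_V^2$ for all $w,v\in V$. Let $m(\cdot,\cdot)$ be a symmetric, continuous and nonnegative bilinear form on $V\times V$. Assume that the solution operator $T:V\to V$ defined by $a(Tf,v)=m(f,v)$ for all $v\in V$ is compact. Consider the eigenvalue problem: find $(\lambda,u)\in\mathbb{R}\times V$, $u\ne0$, such that $$a(u,v)=\lambda\, m(u,v)\qquad\text{for all }v\in V,$$ and, for a random feature trial space $V_{\mathrm{RF}}\subset V$, the discrete eigenvalue problem: find $(\lambda_{\mathrm{RF}},u_{\mathrm{RF}})\in\mathbb{R}\times V_{\mathrm{RF}}$, $u_{\mathrm{RF}}\ne0$, such that $$a(u_{\mathrm{RF}},v_{\mathrm{RF}})=\lambda_{\mathrm{RF}}\, m(u_{\mathrm{RF}},v_{\mathrm{RF}})\qquad\text{for all }v_{\mathrm{RF}}\in V_{\mathrm{RF}}.$$ Let $\lambda$ be an eigenvalue of the continuous problem with multiplicity $q$, let $E$ be the corresponding eigenspace, and set $$\eta_{\mathrm{RF}}(E):=\sup_{u\in E,\ \|u\|_V=1}\ \inf_{w_{\mathrm{RF}}\in V_{\mathrm{RF}}}\|u-w_{\mathrm{RF}}\|_V .$$ Then, for $V_{\mathrm{RF}}$ sufficiently rich, the discrete problem has exactly $q$ eigenvalues $\{\lambda_{\mathrm{RF},j}\}_{j=1}^{q}$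 converging to $\lambda$, counted with multiplicity. Let $E_{\mathrm{RF}}$ be the space spanned by the corresponding discrete eigenfunctions. Then there exists a constant $C>0$, independent of $V_{\mathrm{RF}}$, such that $$\sup_{u\in E,\ \|u\|_V=1}\ \inf_{v\in E_{\mathrm{RF}}}\|u-v\|_V\le C\,\eta_{\mathrm{RF}}(E),\qquad \max_{1\le j\le q}|\lambda-\lambda_{\mathrm{RF},j}|\le C\,\eta_{\mathrm{RF}}(E)^2 .$$
   Context: $V_{\mathrm{RF}}$ denotes a random linear trial space generated by finite random feature expansions, i.e. the set of linear combinations of finitely many sampled feature functions (for example $x\mapsto\cos(w_j^{\top}x+b_j)$ with randomly sampled $w_j,b_j$, $1\le j\le N$); it is assumed to be contained in $V$. The bounds do not depend on the particular random feature realization; they rely only on the stability of the underlying problem and on the approximation capacity of $V_{\mathrm{RF}}$. The phrases ''sufficiently rich'' and ''converging to $\lambda$'' are the paper's own wording and are not quantified further there. *)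

(* Defs.v *)
From HB Require Import structures.
From mathcomp Require Import all_boot all_order all_algebra sesquilinear.
From mathcomp Require Import all_classical all_reals all_analysis.
Import Order.TTheory GRing.Theory Num.Theory numFieldNormedType.Exports.

Set Implicit Arguments.
Unset Strict Implicit.
Unset Printing Implicit Defensive.

Local Open Scope classical_set_scope.
Local Open Scope ring_scope.

Section LinearAlgebra.
Context {R : nzRingType} {V : lmodType R}.

Definition linear_span (A : set V) : set V :=
  [set x | exists n (c : 'I_n -> R) (v : 'I_n -> V),
     (forall i, A (v i)) /\ x = \sum_(i < n) c i *: v i].

Definition linearly_independent n (e : 'I_n -> V) : Prop :=
  forall c : 'I_n -> R, \sum_(i < n) c i *: e i = 0 -> forall i, c i = 0.

Definition has_dim (A : set V) (n : nat) : Prop :=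
  exists e : 'I_n -> V, linearly_independent e /\ A = linear_span (range e).

(* [phi w] is the feature function with parameter [w]; [theta] is one
   realization of the [N] randomly sampled parameters. *)
Definition rf_space (Theta : Type) (phi : Theta -> V) (N : nat)
    (theta : 'I_N -> Theta) : set V :=
  linear_span (range (phi \o theta)).

(* W = setT is the continuous problem, W = rf_space phi theta the discrete
   one.  The zero vector is included. *)
Definition form_eigenspace (a m : V -> V -> R) (W : set V) (mu : R) : set V :=
  [set u | W u /\ forall v, W v -> a u v = mu * m u v].

Definition form_eigenvalue (a m : V -> V -> R) (W : set V) (mu : R) : Prop :=
  exists2 u, form_eigenspace a m W mu u & u != 0.

(* The span of the eigenfunctions belonging to the listed eigenvalues. *)
Definition eigenfunction_span (a m : V -> V -> R) (W : set V)
    q (mu : 'I_q -> R) : set V :=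
  linear_span (\bigcup_j form_eigenspace a m W (mu j)).

End LinearAlgebra.

Section NormedSpace.
Context {R : realType} {V : normedModType R}.

Definition compact_operator (T : V -> V) : Prop :=
  forall A : set V, bounded_set A -> precompact (T @` A).

(* The infimum is over a set bounded below by 0, and nonempty when W is a
   subspace. *)
Definition dist_to (u : V) (W : set V) : R := inf [set `|u - w| | w in W].

(* When E is a nonzero subspace and W a subspace, the supremum is over a
   nonempty set bounded above by 1. *)
Definition gap (E W : set V) : R :=
  sup [set dist_to u W | u in [set u | E u /\ `|u| = 1]].

End NormedSpace.

(* Main.v *)
(* Write [nu = 1 / lam], so that [E = ker (T - nu)], let [P] be the projection onto
   the trial space that is orthogonal for [a], and measure lengths in the energy
   norm of [a].  Two facts use compactness of [T]: [T - nu] is bounded below, by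
   some [delta], on the orthogonal complement of [E], and [(1 - P) T] tends to 0 in
   operator norm along [F].  The rest is quantitative linear algebra in one trial
   space, diagonalised by an [a]-orthonormal basis [e k] with
   [m(e k, .) = sig k a(e k, .)].  Consider the cluster of the [k] with
   [|sig k - nu| < r].  Projecting [E] onto the cluster costs at most a multiple of
   [|u - P u|], so the cluster has at least [q] members; a vector of the cluster
   orthogonal to [E] would contradict the lower bound [delta], so it has at most
   [q].  The quadratic rate comes from pairing an error of a discrete eigenvector
   with an error of a continuous one. *)

Require Import Defs.
From HB Require Import structures.
From mathcomp Require Import all_boot all_order all_algebra sesquilinear.
From mathcomp Require Import spectral complex ring lra.
From mathcomp Require Import all_classical all_reals all_analysis.
Import Order.TTheory GRing.Theory Num.Theory numFieldNormedType.Exports.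

Set Implicit Arguments.
Unset Strict Implicit.
Unset Printing Implicit Defensive.

Local Open Scope classical_set_scope.
Local Open Scope ring_scope.

(** * Linear spans and real symmetric matrices *)

(** Over the complex extension the matrix is hermitian, so the spectral theorem yields a real
    eigenvalue [k]. Being a root of the characteristic polynomial, which has real coefficients, [k]
    is already an eigenvalue over [R]. *)
Lemma symmetric_real_eigenvector (R : rcfType) n (A : 'M[R]_n.+1) :
  A^T = A -> exists (x : 'rV[R]_n.+1) (r : R), x != 0 /\ x *m A = r *: x.
Proof.
move=> Asym; pose B := map_mx (real_complex R) A.
have Bsym : B \is symmetricmx.
  by apply/is_hermitianmxP; rewrite expr0 scale1r map_mx_id // map_trmx Asym.
have Breal : B \is a mxOver Num.real.
  by apply/mxOverP => i j; rewrite mxE complex_real.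
have Bherm := realsym_hermsym Bsym Breal.
have /mxOverP/(_ 0 0)/complex_realP [k Dk] := hermitian_spectral_diag_real Bherm.
have /hermitian_normalmx/orthomx_spectralP Beq := Bherm.
pose P := spectralmx B; have Punit : P \in unitmx := spectral_unit B.
have rowP0 : row 0 P *m B = k%:C%C *: row 0 P.
  rewrite Beq -/P !mulmxA -row_mul mulmxV // row1 -rowE row_diag_mx Dk.
  by rewrite -scalemxAl -rowE.
have : eigenvalue B k%:C%C.
  apply/eigenvalueP; exists (row 0 P) => //.
  apply: contraTneq Punit => P0; rewrite -row_free_unit -kermx_eq0.
  apply/negP => /eqP K0.
  have : (delta_mx 0 0 : 'rV_n.+1) *m P == 0 by rewrite -rowE P0.
  rewrite -sub_kermx K0 submx0 => /eqP/matrixP/(_ 0 0).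
  by rewrite !mxE => /eqP; rewrite oner_eq0.
rewrite eigenvalue_root_char -map_char_poly fmorph_root -eigenvalue_root_char.
by move=> /eigenvalueP [x xA x0]; exists x, k.
Qed.

Section Spans.
Context {R : nzRingType} {V : lmodType R}.
Implicit Types A B : set V.

Lemma linear_span0 A : linear_span A 0.
Proof. by exists 0%N, (fun=> 0), (fun=> 0); rewrite big_ord0; split=> // -[]. Qed.

Lemma linear_span_incl A : A `<=` linear_span A.
Proof.
by move=> x Ax; exists 1%N, (fun=> 1), (fun=> x); rewrite big_ord1 scale1r.
Qed.

Lemma linear_spanZ A c x : linear_span A x -> linear_span A (c *: x).
Proof.
move=> [n [d [v [Av ->]]]]; exists n, (fun i => c * d i), v; split => //.
by rewrite scaler_sumr; apply: eq_bigr => i _; rewrite scalerA.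
Qed.

Lemma linear_spanD A x y :
  linear_span A x -> linear_span A y -> linear_span A (x + y).
Proof.
move=> [n [c [v [Av ->]]]] [p [d [w [Aw ->]]]].
exists (n + p)%N,
  (fun i => match fintype.split i with inl j => c j | inr j => d j end),
  (fun i => match fintype.split i with inl j => v j | inr j => w j end).
split; first by move=> i; case: (fintype.split i).
rewrite big_split_ord /=; congr (_ + _); apply: eq_bigr => i _.
  by rewrite (unsplitK (inl _ i)).
by rewrite (unsplitK (inr _ i)).
Qed.

Lemma linear_span_sum A (J : Type) (r : seq J) (P : pred J) (c : J -> R) (v : J -> V) :
  (forall j, P j -> linear_span A (v j)) ->
  linear_span A (\sum_(j <- r | P j) c j *: v j).
Proof.
move=> Av; elim/big_ind : _ => [||j Pj]; first exact: linear_span0.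
- by move=> x y; exact: linear_spanD.
- by apply: linear_spanZ; exact: Av.
Qed.

Lemma linear_spanB A x y :
  linear_span A x -> linear_span A y -> linear_span A (x - y).
Proof.
by move=> Ax Ay; rewrite -scaleN1r; apply: linear_spanD => //; exact: linear_spanZ.
Qed.

Lemma linear_span_min A B : A `<=` linear_span B -> linear_span A `<=` linear_span B.
Proof. by move=> AB _ [n [c [v [Av ->]]]]; apply: linear_span_sum => i _; apply: AB. Qed.

(** Elements of [linear_span] may repeat generators and use combinations of any length; choosing an
    index for each term and summing coefficients over equal indices leaves one coefficient per
    index. *)
Lemma linear_span_rangeP n (v : 'I_n -> V) x :
  linear_span (range v) x <-> exists c : 'I_n -> R, x = \sum_i c i *: v i.
Proof.
split=> [[p [c [w [rw ->]]]]|[c ->]]; last first.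
  by apply: linear_span_sum => i _; apply: linear_span_incl; exists i.
have [f fE] : {f : 'I_p -> 'I_n & forall i, v (f i) = w i}.
  by apply: (@choice _ _ (fun i j => v j = w i)) => i; have [j _] := rw i; exists j.
exists (fun j => \sum_(i | f i == j) c i).
under [RHS]eq_bigr do rewrite scaler_suml.
rewrite (exchange_big_dep xpredT) //=; apply: eq_bigr => i _.
by rewrite (big_pred1 (f i)) ?fE // => j; rewrite /= eq_sym.
Qed.

End Spans.

(** The rank is at most [k < p], so the left kernel is nonzero. The dimension counts below rest on
    this. *)
Lemma exists_mulmx_eq0 (R : fieldType) p k (M : 'M[R]_(p, k)) :
  (k < p)%N -> exists2 x : 'rV[R]_p, x != 0 & x *m M = 0.
Proof.
move=> kp; have /matrix0Pn [i [j Kij]] : kermx M != 0.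
  rewrite -mxrank_eq0 mxrank_ker subn_eq0 -ltnNge.
  exact: leq_ltn_trans (rank_leq_col M) kp.
exists (row i (kermx M)); first by apply/rV0Pn; exists j; rewrite mxE.
by apply/sub_kermxP; exact: row_sub.
Qed.

Section Fcons.
Context {T : Type} {n : nat}.

Definition fcons (x : T) (f : 'I_n -> T) : 'I_n.+1 -> T :=
  fun i => oapp f x (unlift ord0 i).

Lemma fcons0 x f : fcons x f ord0 = x.
Proof. by rewrite /fcons unlift_none. Qed.

Lemma fconsS x f i : fcons x f (lift ord0 i) = f i.
Proof. by rewrite /fcons liftK. Qed.

End Fcons.

(** * Orthonormal families *)

Section SymmetricForm.
Context {R : rcfType} {V : lmodType R} (a : {symmetric V}).
Implicit Types u v w : V.

Lemma sformC u v : a u v = a v u.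
Proof. by rewrite hermC expr0 mul1r. Qed.

Lemma sformDl u v w : a (u + v) w = a u w + a v w.
Proof. by rewrite linearDl. Qed.

Lemma sformBl u v w : a (u - v) w = a u w - a v w.
Proof. by rewrite linearBl. Qed.

Lemma sformZl c u w : a (c *: u) w = c * a u w.
Proof. by rewrite linearZl_LR. Qed.

Lemma sform0l w : a 0 w = 0.
Proof. by rewrite linear0l. Qed.

Lemma sform_suml (J : Type) (r : seq J) (P : pred J) (c : J -> R) (e : J -> V) w :
  a (\sum_(j <- r | P j) c j *: e j) w = \sum_(j <- r | P j) c j * a (e j) w.
Proof.
elim/big_rec2 : _ => [|j x y _ <-]; first exact: sform0l.
by rewrite sformDl sformZl.
Qed.

Lemma sformDr u v w : a w (u + v) = a w u + a w v.
Proof. by rewrite linearDr. Qed.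

Lemma sformBr u v w : a w (u - v) = a w u - a w v.
Proof. by rewrite linearBr. Qed.

Lemma sformZr c u w : a w (c *: u) = c * a w u.
Proof. by rewrite linearZ_LR. Qed.

Lemma sform_sumr (J : Type) (r : seq J) (P : pred J) (c : J -> R) (e : J -> V) w :
  a w (\sum_(j <- r | P j) c j *: e j) = \sum_(j <- r | P j) c j * a w (e j).
Proof. by rewrite sformC sform_suml; apply: eq_bigr => j _; rewrite sformC. Qed.

End SymmetricForm.

Section OrthonormalFamily.
Context {R : rcfType} {V : lmodType R} (a : {symmetric V}).
Implicit Types u v w : V.

Definition orthofam n (e : 'I_n -> V) := forall i j, a (e i) (e j) = (i == j)%:R.

(** For [a]-orthonormal [e] this is the Ritz projection onto the span of [e], the map [P] of the
    overview. *)
Definition oproj n (e : 'I_n -> V) u := \sum_i a u (e i) *: e i.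

Section Fixed.
Context {n : nat} {e : 'I_n -> V} (oe : orthofam e).

Lemma orthofam_coef (P : pred 'I_n) (c : 'I_n -> R) k :
  a (\sum_(i | P i) c i *: e i) (e k) = if P k then c k else 0.
Proof.
rewrite sform_suml; case: ifP => Pk.
  rewrite (bigD1 k) //= oe eqxx mulr1 big1 ?addr0 // => i /andP[_ ik].
  by rewrite oe (negPf ik) mulr0.
rewrite big1 // => i Pi; rewrite oe; case: eqVneq => [ik|]; last by rewrite mulr0.
by rewrite -ik Pi in Pk.
Qed.

Lemma orthofam_indep : linearly_independent e.
Proof. by move=> c ce k; rewrite -[LHS](orthofam_coef predT) ce sform0l. Qed.

Lemma orthofam_dot (P : pred 'I_n) (c d : 'I_n -> R) :
  a (\sum_(i | P i) c i *: e i) (\sum_(i | P i) d i *: e i) = \sum_(i | P i) c i * d i.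
Proof.
rewrite sform_sumr; apply: eq_bigr => i Pi; rewrite orthofam_coef Pi; exact: mulrC.
Qed.

Lemma oproj_span u : linear_span (range e) (oproj e u).
Proof. by apply: linear_span_sum => i _; apply: linear_span_incl; exists i. Qed.

Lemma oproj_id u : linear_span (range e) u -> oproj e u = u.
Proof.
move=> /linear_span_rangeP [c ->]; apply: eq_bigr => i _.
by rewrite orthofam_coef.
Qed.

Lemma oproj_coef u k : a (oproj e u) (e k) = a u (e k).
Proof. exact: (orthofam_coef predT). Qed.

Lemma oproj_ortho u w : linear_span (range e) w -> a (u - oproj e u) w = 0.
Proof.
move=> /linear_span_rangeP [c ->]; rewrite sform_sumr big1 // => i _.
by rewrite sformBl oproj_coef subrr mulr0.
Qed.

Lemma orthofam_fcons w : a w w = 1 -> (forall i, a w (e i) = 0) ->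
  orthofam (fcons w e).
Proof.
move=> ww we i j; case: (unliftP ord0 i) => [i'|] ->; case: (unliftP ord0 j) => [j'|] ->.
- by rewrite !fconsS oe (inj_eq lift_inj).
- by rewrite fconsS fcons0 sformC we.
- by rewrite fconsS fcons0 we.
- by rewrite fcons0 ww eqxx.
Qed.

End Fixed.

Lemma oprojB n (e : 'I_n -> V) u v : oproj e (u - v) = oproj e u - oproj e v.
Proof. by rewrite -sumrB; apply: eq_bigr => i _; rewrite sformBl scalerBl. Qed.

Lemma oprojZ n (e : 'I_n -> V) c u : oproj e (c *: u) = c *: oproj e u.
Proof.
by rewrite /oproj scaler_sumr; apply: eq_bigr => i _; rewrite sformZl scalerA.
Qed.

Lemma oproj_sum n (e : 'I_n -> V) p (c : 'I_p -> R) (v : 'I_p -> V) :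
  oproj e (\sum_j c j *: v j) = \sum_j c j *: oproj e (v j).
Proof.
under [RHS]eq_bigr do rewrite scaler_sumr.
rewrite exchange_big /=; apply: eq_bigr => i _.
by rewrite sform_suml scaler_suml; apply: eq_bigr => j _; rewrite scalerA.
Qed.

(** Orthogonality to the [y j] imposes [k] linear equations on [p > k] coefficients, and
    independence of [x] keeps the resulting vector nonzero. Both halves of the cluster count use
    it. *)
Lemma exists_ortho_combination p k (x : 'I_p -> V) (y : 'I_k -> V) :
  linearly_independent x -> (k < p)%N ->
  exists w, [/\ w != 0, linear_span (range x) w & forall j, a w (y j) = 0].
Proof.
move=> ix kp; pose M := \matrix_(i, j) a (x i) (y j).
have [c c0 cM] := exists_mulmx_eq0 M kp.
exists (\sum_i c 0 i *: x i); split.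
- by apply: contra_neq c0 => /ix c0; apply/rowP => i; rewrite c0 mxE.
- by apply/linear_span_rangeP; exists (fun i => c 0 i).
- move=> j; move/matrixP/(_ 0 j) : cM; rewrite !mxE sform_suml => {2}<-.
  by apply: eq_bigr => i _; rewrite mxE.
Qed.

(** If [n < p], a nonzero left kernel vector of the coefficient matrix would be a nontrivial
    relation among the [x i]. *)
Lemma card_indep_le p n (x : 'I_p -> V) (v : 'I_n -> V) :
  linearly_independent x -> (forall i, linear_span (range v) (x i)) -> (p <= n)%N.
Proof.
move=> ix xv; rewrite leqNgt; apply/negP => np.
have [c cE] : {c : 'I_p -> 'I_n -> R & forall i, x i = \sum_j c i j *: v j}.
  apply: (@choice _ _ (fun i c => x i = \sum_j c j *: v j)) => i.
  exact/linear_span_rangeP.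
have [d /rV0Pn [i di] dM] := exists_mulmx_eq0 (\matrix_(i, j) c i j) np.
case/negP: di; apply/eqP; apply: (ix (fun i => d 0 i)).
under eq_bigr do rewrite cE scaler_sumr.
rewrite exchange_big big1 //= => j _.
under eq_bigr do rewrite scalerA.
rewrite -scaler_suml; move/matrixP/(_ 0 j) : dM; rewrite !mxE => dM.
rewrite -[RHS](scale0r (v j)) -[in RHS]dM; congr (_ *: _).
by apply: eq_bigr => i' _; rewrite mxE.
Qed.

Lemma linear_span_indep_eq p n (x : 'I_p -> V) (v : 'I_n -> V) :
  linearly_independent x -> linearly_independent v ->
  linear_span (range x) = linear_span (range v) -> p = n.
Proof.
move=> ix iv E; apply/eqP; rewrite eqn_leq.
by rewrite (card_indep_le ix (v := v)) ?(card_indep_le iv (v := x)) // => i;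
  [rewrite E|rewrite -E]; apply: linear_span_incl; exists i.
Qed.

End OrthonormalFamily.

(** * Gram-Schmidt and simultaneous diagonalisation of two forms *)

Section PositiveForm.
Context {R : rcfType} {V : lmodType R} (a : {symmetric V}).
Hypothesis a_gt0 : forall v, v != 0 -> 0 < a v v.
Implicit Types u v w : V.

Lemma form_normalize w : w != 0 ->
  a ((Num.sqrt (a w w))^-1 *: w) ((Num.sqrt (a w w))^-1 *: w) = 1.
Proof.
move=> w0; have ww := a_gt0 w0.
rewrite sformZl sformZr mulrA -invfM -expr2 sqr_sqrtr ?mulVf ?gt_eqF //.
exact: ltW.
Qed.

(** The family [v] may be dependent, as sampled features can be: a vector whose residual [w]
    vanishes is dropped, so [k] can be smaller than [n]. *)
Lemma gram_schmidt n (v : 'I_n -> V) : exists k (e : 'I_k -> V),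
  orthofam a e /\ linear_span (range e) = linear_span (range v).
Proof.
elim: n v => [|n IH] v; first by exists 0%N, v; split=> // -[].
have [k [e [oe eE]]] := IH (v \o lift ord0).
pose w := v ord0 - oproj a e (v ord0).
have vE : linear_span (range v) =
    linear_span (v ord0 |` linear_span (range e)).
  rewrite eE; apply/seteqP; split; apply: linear_span_min.
    move=> _ [i _ <-]; apply: linear_span_incl.
    case: (unliftP ord0 i) => [j|] ->; last by left.
    by right; apply: linear_span_incl; exists j.
  move=> x [->|]; first by apply: linear_span_incl; exists ord0.
  apply: linear_span_min => _ [j _ <-]; apply: linear_span_incl.
  by exists (lift ord0 j).
rewrite vE; have [w0|w0] := eqVneq w 0.
  exists k, e; split => //; apply/seteqP; split.
    by move=> x ?; apply: linear_span_incl; right.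
  apply: linear_span_min => x [->|//].
  by move/eqP: w0; rewrite subr_eq0 => /eqP ->; exact: oproj_span.
pose c := Num.sqrt (a w w).
have c0 : c != 0 by rewrite gt_eqF // sqrtr_gt0 a_gt0.
exists k.+1, (fcons (c^-1 *: w) e); split.
  apply: orthofam_fcons => //; first exact: form_normalize.
  move=> i; rewrite sformZl oproj_ortho ?mulr0 //.
  by apply: linear_span_incl; exists i.
apply/seteqP; split; apply: linear_span_min.
  move=> _ [i _ <-]; case: (unliftP ord0 i) => [j|] ->; rewrite ?fconsS ?fcons0.
    by apply: linear_span_incl; right; apply: linear_span_incl; exists j.
  apply: linear_spanZ; apply: linear_spanB; apply: linear_span_incl; first by left.
  by right; exact: oproj_span.
have eS x : linear_span (range e) x -> linear_span (range (fcons (c^-1 *: w) e)) x.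
  apply: linear_span_min => _ [j _ <-]; apply: linear_span_incl.
  by exists (lift ord0 j) => //; rewrite fconsS.
move=> x [->|]; last exact: eS.
rewrite -(subrK (oproj a e (v ord0)) (v ord0)); apply: linear_spanD; last first.
  by apply: eS; exact: oproj_span.
rewrite -/w -[X in linear_span _ X](scalerKV c0); apply: linear_spanZ.
by apply: linear_span_incl; exists ord0 => //; rewrite fcons0.
Qed.

Lemma simultaneous_diagonalization (m : {symmetric V}) n (v : 'I_n -> V) :
  exists k (e : 'I_k -> V) (sig : 'I_k -> R),
  [/\ orthofam a e, linear_span (range e) = linear_span (range v) &
      forall i w, linear_span (range v) w -> m (e i) w = sig i * a (e i) w].
Proof.
pose W := linear_span (range v).
(* Diagonal families of common eigenvectors in [W] are extended one vector at a
   time; linear independence bounds their length by [n]. *)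
suff ext d : exists k (e : 'I_k -> V) (sig : 'I_k -> R),
    [/\ orthofam a e, forall i, W (e i),
        forall i w, W w -> m (e i) w = sig i * a (e i) w &
        linear_span (range e) = W \/ k = d].
  have [k [e [sig [oe eW em [?|kn]]]]] := ext n.+1; first by exists k, e, sig.
  by have := card_indep_le (orthofam_indep oe) eW; rewrite kn ltnn.
elim: d => [|d [k [e [sig [oe eW em [?|kd]]]]]].
- by exists 0%N, (fun=> 0), (fun=> 0); split; by [case|case|case|right].
- by exists k, e, sig; split => //; left.
have spaneW : linear_span (range e) `<=` W.
  by apply: linear_span_min => _ [i _ <-]; exact: eW.
(* The residuals of the generators span the [a]-orthogonal complement of the current eigenvectors in
   [W]; if it is trivial, [e] already spans [W]. *)
pose v' j := v j - oproj a e (v j).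
have [l [f [of_ fE]]] := gram_schmidt v'.
have decomp z : W z -> linear_span (range f) (z - oproj a e z).
  move=> /linear_span_rangeP [c ->]; rewrite fE; apply/linear_span_rangeP.
  exists c; rewrite oproj_sum -sumrB; apply: eq_bigr => j _.
  by rewrite scalerBr.
case: l f of_ fE decomp => [|l] f of_ fE decomp.
  exists k, e, sig; split => //; left; apply/seteqP; split => // z /decomp.
  move=> /linear_span_rangeP [c]; rewrite big_ord0 => /eqP.
  by rewrite subr_eq0 => /eqP ->; exact: oproj_span.
have fW i : W (f i).
  have : linear_span (range f) (f i) by apply: linear_span_incl; exists i.
  rewrite fE; apply: (linear_span_min (A := range v')) => _ [j _ <-].
  apply: linear_spanB; first by apply: linear_span_incl; exists j.
  exact/spaneW/oproj_span.
have af0 i z : linear_span (range e) z -> a (f i) z = 0.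
  move=> ez; have : linear_span (range f) (f i) by apply: linear_span_incl; exists i.
  rewrite fE => /linear_span_rangeP [c ->]; rewrite sform_suml big1 // => j _.
  by rewrite oproj_ortho ?mulr0.
(* Since the [e j] are common eigenvectors, [a]-orthogonality to them inside [W] implies
   [m]-orthogonality, so the next eigenvector can be sought in the complement alone. *)
have mf0 i z : linear_span (range e) z -> m (f i) z = 0.
  move=> /linear_span_rangeP [c ->]; rewrite sform_sumr big1 // => j _.
  rewrite sformC em ?fW // sformC af0 ?mulr0 //.
  by apply: linear_span_incl; exists j.
pose S := \matrix_(i, j) m (f i) (f j).
have [|x [r [x0 xS]]] := @symmetric_real_eigenvector _ _ S.
  by apply/matrixP => i j; rewrite !mxE sformC.
pose w := \sum_i x 0 i *: f i.
have w0 : w != 0.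
  apply: contra_neq x0 => /(orthofam_indep of_) x0.
  by apply/rowP => i; rewrite x0 mxE.
have wW : W w by apply: linear_span_sum => i _; exact: fW.
have aw0 z : linear_span (range e) z -> a w z = 0.
  by move=> ez; rewrite sform_suml big1 // => i _; rewrite af0 ?mulr0.
(* Split [z] along [e] and [f]: on the first part both forms vanish against [w], on the second the
   matrix eigenvector equation applies. *)
have mw z : W z -> m w z = r * a w z.
  move=> Wz; rewrite -(subrK (oproj a e z) z) sformDr [in RHS]sformDr.
  rewrite (aw0 _ (oproj_span _ _)) addr0.
  rewrite {2}/w sform_suml [X in _ + X]big1 ?addr0 => [|i _]; last first.
    by rewrite mf0 ?mulr0 //; exact: oproj_span.
  have /linear_span_rangeP [c ->] := decomp z Wz.
  rewrite !sform_sumr mulr_sumr; apply: eq_bigr => j _.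
  rewrite mulrCA; congr (_ * _).
  rewrite (orthofam_coef of_ predT) sform_suml.
  move/matrixP/(_ 0 j) : xS; rewrite !mxE => <-.
  by apply: eq_bigr => i _; rewrite !mxE.
exists k.+1, (fcons ((Num.sqrt (a w w))^-1 *: w) e), (fcons r sig); split.
- apply: orthofam_fcons => //; first exact: form_normalize.
  move=> i; rewrite sformZl (aw0 (e i)) ?mulr0 //.
  by apply: linear_span_incl; exists i.
- move=> i; case: (unliftP ord0 i) => [j|] ->; rewrite ?fconsS ?fcons0 //.
  exact: linear_spanZ.
- move=> i z Wz; case: (unliftP ord0 i) => [j|] ->; rewrite ?fconsS ?fcons0.
    exact: em.
  by rewrite !sformZl mw // mulrCA.
- by right; rewrite kd.
Qed.

End PositiveForm.

(** * The energy norm *)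

Section EnergyNorm.
Context {R : rcfType} {V : lmodType R} (a : {symmetric V}).
Hypothesis a_gt0 : forall v, v != 0 -> 0 < a v v.
Implicit Types u v w : V.

Definition enorm v : R := Num.sqrt (a v v).

Lemma form_ge0 v : 0 <= a v v.
Proof. by have [->|/a_gt0/ltW] := eqVneq v 0; first rewrite sform0l. Qed.

Lemma enorm_ge0 v : 0 <= enorm v.
Proof. exact: sqrtr_ge0. Qed.

Lemma enorm_sqr v : enorm v ^+ 2 = a v v.
Proof. by rewrite sqr_sqrtr // form_ge0. Qed.

Lemma enorm_gt0 v : v != 0 -> 0 < enorm v.
Proof. by move=> v0; rewrite sqrtr_gt0 a_gt0. Qed.

Lemma enormZ c v : enorm (c *: v) = `|c| * enorm v.
Proof. by rewrite /enorm sformZl sformZr mulrA -expr2 sqrtrM ?sqr_ge0 // sqrtr_sqr. Qed.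

Lemma enorm_normalize v : v != 0 -> enorm ((enorm v)^-1 *: v) = 1.
Proof. by move=> v0; rewrite {1}/enorm (form_normalize a_gt0) // sqrtr1. Qed.

Lemma enormN v : enorm (- v) = enorm v.
Proof. by rewrite -scaleN1r enormZ normrN1 mul1r. Qed.

Lemma enormBC u v : enorm (u - v) = enorm (v - u).
Proof. by rewrite -enormN opprB. Qed.

Lemma enorm_CauchySchwarz u v : `|a u v| <= enorm u * enorm v.
Proof.
rewrite -sqrtrM ?form_ge0 // -sqrtr_sqr ler_wsqrtr //.
have [->|v0] := eqVneq v 0; first by rewrite sformC !sform0l expr0n mulr0.
(* The form takes the value [a v v * (a u u * a v v - (a u v) ^+ 2)] at this vector, and [a v v] is
   positive. *)
have := form_ge0 (a v v *: u - a u v *: v); have := a_gt0 v0.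
rewrite sformBl !sformBr !sformZl !sformZr (sformC a v u); nra.
Qed.

Lemma enormD u v : enorm (u + v) <= enorm u + enorm v.
Proof.
rewrite -ler_sqr ?nnegrE ?addr_ge0 ?enorm_ge0 // enorm_sqr sqrrD !enorm_sqr.
have := le_trans (ler_norm _) (enorm_CauchySchwarz u v).
by rewrite sformDl !sformDr (sformC a v u); nra.
Qed.

Lemma enormB_trans w u v : enorm (u - v) <= enorm (u - w) + enorm (w - v).
Proof. by apply: le_trans (enormD _ _); rewrite addrA subrK. Qed.

Lemma enorm_pythagoras u v : a u v = 0 ->
  enorm (u + v) ^+ 2 = enorm u ^+ 2 + enorm v ^+ 2.
Proof. by move=> uv; rewrite !enorm_sqr sformDl !sformDr (sformC a v u) uv addr0 add0r. Qed.

Section Projection.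
Context {n : nat} {e : 'I_n -> V} (oe : orthofam a e).

Lemma enorm_oproj u : enorm (oproj a e u) <= enorm u.
Proof.
have := enorm_pythagoras (oproj_ortho oe u (oproj_span a u)).
rewrite subrK => uE; rewrite -ler_sqr ?nnegrE ?enorm_ge0 // uE lerDr.
exact: sqr_ge0.
Qed.

Lemma oproj_best u w : linear_span (range e) w ->
  enorm (u - oproj a e u) <= enorm (u - w).
Proof.
move=> ew; have eP : linear_span (range e) (oproj a e u - w).
  by apply: linear_spanB => //; exact: oproj_span.
have := enorm_pythagoras (oproj_ortho oe u eP).
rewrite addrA subrK => uE; rewrite -ler_sqr ?nnegrE ?enorm_ge0 // uE lerDl.
exact: sqr_ge0.
Qed.

(** Squared norms are sums of squared coefficients, so norm estimates reduce to coefficientwise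
    ones; enlarging the index set adds only nonnegative terms. *)
Lemma enorm_combination_le (P Q : pred 'I_n) (c d : 'I_n -> R) :
  (forall i, P i -> Q i) -> (forall i, P i -> `|c i| <= `|d i|) ->
  enorm (\sum_(i | P i) c i *: e i) <= enorm (\sum_(i | Q i) d i *: e i).
Proof.
move=> PQ cd; apply: ler_wsqrtr; rewrite !orthofam_dot //.
rewrite big_mkcond [leRHS]big_mkcond; apply: ler_sum => i _.
case: ifP => [Pi|_]; last by case: ifP => // _; rewrite -expr2 sqr_ge0.
by rewrite PQ // -!expr2 -real_normK ?num_real // -[leRHS]real_normK ?num_real //
  ler_sqr ?nnegrE ?cd.
Qed.

End Projection.

Lemma form_nondeg u v : (forall w, a u w = a v w) -> u = v.
Proof.
move=> uv; apply/eqP; rewrite -subr_eq0; apply/negPn/negP => /a_gt0.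
by rewrite sformBl uv subrr ltxx.
Qed.

End EnergyNorm.

(** * The discrete spectrum near an eigenvalue *)

Section SolutionOperator.
Context {R : rcfType} {V : lmodType R} (a m : {symmetric V}) (T : V -> V).
Hypothesis a_gt0 : forall v, v != 0 -> 0 < a v v.
Hypothesis T_def : forall u v, a (T u) v = m u v.

(** [T] is given only as a function; it inherits linearity from [m] because [a] is nondegenerate. *)
Lemma solution_operatorB u v : T (u - v) = T u - T v.
Proof. by apply: (form_nondeg a_gt0) => w; rewrite sformBl !T_def sformBl. Qed.

Lemma solution_operatorZ c u : T (c *: u) = c *: T u.
Proof. by apply: (form_nondeg a_gt0) => w; rewrite sformZl !T_def sformZl. Qed.

End SolutionOperator.

Section DiscreteSpectrum.
Context {R : rcfType} {V : lmodType R} (a m : {symmetric V}).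
Hypothesis a_gt0 : forall v, v != 0 -> 0 < a v v.
Context (T : V -> V) (L nu delta : R) (q : nat) (f : 'I_q -> V).
Hypothesis T_def : forall u v, a (T u) v = m u v.
Hypothesis T_le : forall v, enorm a (T v) <= L * enorm a v.
Hypothesis (L_ge0 : 0 <= L) (nu_gt0 : 0 < nu) (delta_gt0 : 0 < delta).
Hypothesis of_ : orthofam a f.
Let E := linear_span (range f).
Hypothesis TE : forall u, E u -> T u = nu *: u.
Hypothesis T_gap : forall v, (forall j, a v (f j) = 0) ->
  delta * enorm a v <= enorm a (T v - nu *: v).

Local Notation N := (enorm a).

Let TB := solution_operatorB a_gt0 T_def.

Context (n : nat) (e : 'I_n -> V) (sig : 'I_n -> R) (eps : R).
Hypothesis oe : orthofam a e.
Let W := linear_span (range e).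
Hypothesis e_sig : forall i w, W w -> m (e i) w = sig i * a (e i) w.
Hypothesis T_approx : forall v, N (T v - oproj a e (T v)) <= eps * N v.

(* The bound [nu / 2] keeps the discrete eigenvalues [sig k] of the cluster away
   from 0; the bound [delta / 4] keeps their eigenvectors close to [E]. *)
Definition gap_radius := Num.min (delta / 4) (nu / 2).
Let r := gap_radius.

Lemma gap_radius_gt0 : 0 < r.
Proof. by rewrite lt_min !divr_gt0. Qed.

Let r_gt0 := gap_radius_gt0.
Let r_delta : r <= delta / 4.
Proof. by rewrite ge_min lexx. Qed.
Let r_nu : r <= nu / 2.
Proof. by rewrite ge_min lexx orbT. Qed.

Hypothesis eps_ge0 : 0 <= eps.
Hypothesis eps_delta : eps <= delta / 4.
Hypothesis eps_nu : eps <= nu.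
Hypothesis eps_small : (1 + L / r) * eps < nu.

Let B := [pred k | `|sig k - nu| < r].

Let e_in i : W (e i).
Proof. by apply: linear_span_incl; exists i. Qed.

Let m_e u k : W u -> m u (e k) = sig k * a u (e k).
Proof. by move=> Wu; rewrite sformC e_sig // sformC. Qed.

(** On [E] one has [T u = nu *: u], so approximating [T u] approximates [u] at the price of a factor
    [1 / nu]. *)
Lemma eigenspace_approx u : E u -> N (u - oproj a e u) <= eps / nu * N u.
Proof.
move=> Eu; have := T_approx u; rewrite TE // oprojZ.
rewrite -scalerBr enormZ gtr0_norm // => le.
by rewrite mulrAC ler_pdivlMr // mulrC.
Qed.

Lemma cluster_proj_le u : E u ->
  N (u - \sum_(k | B k) a u (e k) *: e k) <= (1 + L / r) * N (u - oproj a e u).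
Proof.
move=> Eu; set z := \sum_(k | _) _.
(* Besides the Ritz error of [u] there remains the part of [P u] outside the cluster, which is at
   most [L / r] times that error. *)
apply: le_trans (enormB_trans a_gt0 (oproj a e u) _ _) _.
rewrite mulrDl mul1r lerD2l mulrAC ler_pdivlMr // mulrC.
(* The coefficients of [P T (P u - u)] in the basis [e] are
   [(sig k - nu) a(u, e k)], and [|sig k - nu| >= r] outside the cluster. *)
have -> : oproj a e u - z = \sum_(k | ~~ B k) a u (e k) *: e k.
  by rewrite /oproj (bigID B) /= addrC addrK.
rewrite -[r]gtr0_norm // -enormZ scaler_sumr.
under eq_bigr do rewrite scalerA.
have <- : N (oproj a e u - u) = N (u - oproj a e u) by exact: enormBC.
apply: le_trans (T_le _); apply: le_trans (enorm_oproj a_gt0 oe _).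
apply: (enorm_combination_le oe) => // k.
rewrite /= -leNgt T_def sformBl m_e; last exact: oproj_span.
rewrite (oproj_coef oe) -T_def TE // sformZl -mulrBl !normrM => rk.
by rewrite ler_wpM2r // gtr0_norm.
Qed.

Lemma cluster_card : #|B| = q.
Proof.
pose g : 'I_#|B| -> 'I_n := enum_val.
have gB j : B (g j) by exact: (enum_valP j).
apply/eqP; rewrite eqn_leq; apply/andP; split; rewrite leqNgt; apply/negP => lt.
- (* Otherwise the cluster contains [w != 0] orthogonal to [E], on which [T - nu]
     is both small and bounded below. *)
  have ig : linearly_independent (e \o g).
    apply: (@orthofam_indep _ _ a) => i j; rewrite oe /g.
    by rewrite (inj_eq enum_val_inj).
  have [w [w0 we wf]] := exists_ortho_combination a f ig lt.
  have Ww : W w.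
    by apply: (linear_span_min _ we) => _ [j _ <-]; exact: e_in.
  have wB k : ~~ B k -> a w (e k) = 0.
    move=> Bk; move/linear_span_rangeP : we => [c ->].
    rewrite sform_suml big1 // => j _; rewrite /= oe.
    case: eqVneq => [gk|]; last by rewrite mulr0.
    by rewrite -gk gB in Bk.
  have Nw : 0 < N w by exact: enorm_gt0.
  have := T_gap wf; apply/negP; rewrite -ltNge.
  apply: le_lt_trans (enormB_trans a_gt0 (oproj a e (T w)) _ _) _.
  have le1 := T_approx w.
  suff le2 : N (oproj a e (T w) - nu *: w) <= r * N w.
    (* Both [eps] and [r] are at most [delta / 4], so their sum stays below [delta]. *)
    apply: le_lt_trans (lerD le1 le2) _; rewrite -mulrDl ltr_pM2r //.
    move: r_delta delta_gt0 eps_delta; lra.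
  have wE := esym (oproj_id oe Ww).
  have -> : oproj a e (T w) - nu *: w =
      \sum_k (a (T w) (e k) - nu * a w (e k)) *: e k.
    rewrite {2}wE scaler_sumr -sumrB.
    by apply: eq_bigr => k _; rewrite scalerA -scalerBl.
  rewrite -[r]gtr0_norm // -enormZ {3}wE scaler_sumr.
  under [in leRHS]eq_bigr do rewrite scalerA.
  apply: (enorm_combination_le oe) => // k _.
  rewrite T_def m_e // -mulrBl !normrM.
  have [Bk|Bk] := boolP (B k); last by rewrite wB // normr0 !mulr0.
  by rewrite ler_wpM2r // [leRHS]gtr0_norm // ltW.
(* With fewer than [q] members, some nonzero [u] in [E] is orthogonal to the cluster. Its cluster
   projection is then 0, with error [N u], while [eps_small] makes the bound on this error strictly
   smaller than [N u]. *)
- have [u [u0 uf ug]] := exists_ortho_combination a (e \o g) (orthofam_indep of_) lt.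
  have Nu : 0 < N u by exact: enorm_gt0.
  have := cluster_proj_le uf; rewrite big1 => [|k Bk]; last first.
    have := ug (enum_rank_in Bk k); rewrite /= /g enum_rankK_in // => ->.
    by rewrite scale0r.
  rewrite subr0; apply/negP; rewrite -ltNge.
  apply: le_lt_trans (ler_wpM2l _ (eigenspace_approx uf)) _.
    by rewrite addr_ge0 ?divr_ge0 // ltW.
  by rewrite !mulrA gtr_pMl // ltr_pdivrMr // mul1r.
Qed.

(* For [w := e k] and its projection [u] onto [E], one has
   [(sig k - nu) a(w, u) = a(T w - P T w, P u - u)], a product of two
   approximation errors; the first one is itself [O(h)] because it differs from
   [nu (u - P u)] by at most [eps |w - u|], which can be absorbed. *)
Lemma eigenvalue_rate h k : B k -> 0 <= h ->
  (forall u, E u -> N (u - oproj a e u) <= h * N u) ->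
  `|sig k - nu| <= 4 * nu * h ^+ 2.
Proof.
move=> Bk h0 hE; pose w := e k; pose u := oproj a f w.
have Nw : N w = 1 by rewrite /enorm oe eqxx sqrtr1.
have Eu : E u by exact: oproj_span.
have Nu : N u <= 1 by rewrite -Nw; exact: enorm_oproj.
pose x := N (T w - oproj a e (T w)).
pose y := N (w - u).
pose z := `|sig k - nu|.
have PTw : oproj a e (T w) = sig k *: w.
  rewrite -[RHS](oproj_id oe (linear_spanZ _ (e_in k))).
  by apply: eq_bigr => i _; rewrite T_def e_sig // sformZl.
have xeps : x <= eps by have := T_approx w; rewrite Nw mulr1.
have zr : z < r by [].
(* [w - u] is orthogonal to [E], so [T_gap] applies. As [T u = nu *: u], the vector on its right
   side is [T w - nu *: w], the sum of [T w - P T w] and [(sig k - nu) *: w]. *)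
have ydelta : delta * y <= z + x.
  have wf j : a (w - u) (f j) = 0.
    by apply: oproj_ortho => //; apply: linear_span_incl; exists j.
  apply: le_trans (T_gap wf) _.
  rewrite TB (TE Eu) scalerBr opprB addrA subrK.
  rewrite [z + x]addrC; apply: le_trans (enormB_trans a_gt0 (sig k *: w) _ _) _.
  rewrite -PTw lerD2l PTw -scalerBl enormZ Nw mulr1 //.
have y2 : y <= 1 / 2.
  rewrite -(ler_pM2l delta_gt0); apply: le_trans ydelta _.
  by move: r_delta eps_delta xeps zr; lra.
have xh : x <= nu * h + eps * y.
  have -> : x = N ((T u - oproj a e (T u)) +
      (T (w - u) - oproj a e (T (w - u)))).
    rewrite TB oprojB [in RHS]opprB addrACA addKr.
    by rewrite [T u + _]addrC subrK.
  apply: le_trans (enormD a_gt0 _ _) _; apply: lerD; last exact: T_approx.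
  rewrite TE //.
  rewrite oprojZ -scalerBr enormZ gtr0_norm // ler_pM2l //.
  apply: le_trans (hE _ Eu) _; exact: ler_piMr.
have y0 : 0 <= y by exact: enorm_ge0.
have awu : a w u = N u ^+ 2.
  rewrite enorm_sqr //; apply/eqP.
  by rewrite -subr_eq0 -sformBl oproj_ortho.
have Nu34 : 3 / 4 <= N u ^+ 2.
  have := enorm_pythagoras a_gt0 (oproj_ortho of_ w Eu).
  rewrite subrK -/y Nw expr1n.
  by move: y2 y0; nra.
have zE d : N (u - oproj a e u) <= d -> z * N u ^+ 2 <= x * d.
  move=> ud; rewrite -{1}[N u ^+ 2]ger0_norm ?sqr_ge0 // -normrM -awu.
  have -> : (sig k - nu) * a w u = a (T w - oproj a e (T w)) (oproj a e u - u).
    rewrite sformBr oproj_ortho //; last exact: oproj_span.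
    rewrite sub0r sformBl PTw sformZl T_def (sformC m w u) -T_def TE // sformZl.
    by rewrite (sformC a u w) opprB mulrBl.
  apply: le_trans (enorm_CauchySchwarz a_gt0 _ _) _.
  by rewrite ler_wpM2l ?enorm_ge0 // enormBC.
have x0 : 0 <= x by exact: enorm_ge0.
have z0 : 0 <= z by exact: normr_ge0.
have z1 : z * N u ^+ 2 <= x * h.
  by apply: zE; apply: le_trans (hE _ Eu) _; exact: ler_piMr.
(* This cruder bound, [z <= 4 / 3 * x], allows [z] to be absorbed into [x] in the estimate of
   [x]. *)
have z2 : z * N u ^+ 2 <= x * 1.
  apply: zE; apply: le_trans (eigenspace_approx Eu) _; apply: mulr_ile1 => //.
  - by rewrite divr_ge0 // ltW.
  - exact: enorm_ge0.
  - by rewrite ler_pdivrMr // mul1r.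
have z34 : z * (3 / 4) <= z * N u ^+ 2 by rewrite ler_wpM2l.
have epsy : eps * y <= delta / 4 * y by rewrite ler_wpM2r.
rewrite -/z.
(* From [x <= nu * h + (z + x) / 4] and [z <= 4 / 3 * x] one gets [5 / 12 * x <= nu * h]. With [z1]
   this gives [z <= 16 / 5 * nu * h ^+ 2], below the claimed constant 4. *)
have x3 : x <= 12 / 5 * (nu * h) by move: epsy ydelta xh z2 z34; lra.
have : x * h <= 12 / 5 * (nu * h) * h by rewrite ler_wpM2r.
move: z1 z34; nra.
Qed.

(** Tested against [e k], the eigenvalue equation reads [a u (e k) = x * sig k * a u (e k)], so only
    coordinates with [sig k = x^-1] survive. The case [x = 0] is excluded because [0^-1 = 0] would
    count the [k] with [sig k = 0]. *)
Lemma discrete_eigenspace_dim x : x != 0 ->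
  has_dim (form_eigenspace a m W x) #|[pred k | sig k == x^-1]|.
Proof.
move=> x0; set P := [pred k | _].
exists (fun i : 'I_#|P| => e (enum_val i)); split.
  apply: (@orthofam_indep _ _ a) => i j.
  by rewrite oe (inj_eq enum_val_inj).
apply/seteqP; split=> [u [Wu uE]|].
  rewrite -(oproj_id oe Wu); rewrite /oproj (bigID P) /= [X in _ + X]big1 ?addr0.
    apply: linear_span_sum => k Pk; apply: linear_span_incl.
    by exists (enum_rank_in Pk k); rewrite // enum_rankK_in.
  move=> k Pk; suff -> : a u (e k) = 0 by rewrite scale0r.
  move: (uE _ (e_in k)); rewrite m_e // => /eqP.
  rewrite mulrA -subr_eq0 -{1}[a u (e k)]mul1r -mulrBl mulf_eq0 subr_eq0.
  case/orP => [|/eqP//] /eqP xs; case/negP: Pk; apply/eqP.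
  by apply: (mulfI x0); rewrite -xs mulfV.
have PE i : form_eigenspace a m W x (e (@enum_val _ P i)).
  split; first exact: e_in.
  move=> v Wv; rewrite e_sig // mulrA; have /eqP -> := enum_valP i.
  by rewrite mulfV // mul1r.
move=> u /linear_span_rangeP [c ->]; split.
  by apply: linear_span_sum => i _; exact: e_in.
move=> v Wv; rewrite !sform_suml mulr_sumr; apply: eq_bigr => i _.
by have [_ ->] := PE i; rewrite // mulrCA.
Qed.

(** For [x > nu^-1 / 2], inversion expands the distance to [nu^-1] by at most [2 * nu ^+ 2]; this
    radius therefore lands within [r] of [nu]. *)
Definition isolation_radius := r / (2 * nu ^+ 2).

Lemma inverse_near x : `|x - nu^-1| < isolation_radius ->
  x != 0 /\ `|x^-1 - nu| < r.
Proof.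
(* The bound [r <= nu / 2] keeps [x] away from 0. *)
move=> xr; have rho : isolation_radius <= nu^-1 / 4.
  rewrite /isolation_radius.
  have -> : nu^-1 / 4 = (nu / 2) / (2 * nu ^+ 2) by field; rewrite gt_eqF.
  by rewrite ler_wpM2r // invr_ge0 mulr_ge0 // sqr_ge0.
have nuV : 0 < nu^-1 by rewrite invr_gt0.
have x_gt : nu^-1 / 2 < x by move: xr; rewrite ltr_norml; lra.
have x0 : 0 < x by lra.
split; first by rewrite gt_eqF.
have -> : x^-1 - nu = - (nu / x) * (x - nu^-1).
  by field; rewrite !gt_eqF.
rewrite normrM normrN (gtr0_norm (divr_gt0 nu_gt0 x0)).
have nux : nu / x <= 2 * nu ^+ 2.
  rewrite ler_pdivrMr // -ler_pdivrMl ?mulr_gt0 ?exprn_gt0 //.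
  have -> : (2 * nu ^+ 2)^-1 * nu = nu^-1 / 2 by field; rewrite gt_eqF.
  exact: ltW.
apply: le_lt_trans (ler_wpM2r (normr_ge0 _) nux) _.
by rewrite mulrC -ltr_pdivlMr // mulr_gt0 // exprn_gt0.
Qed.

Lemma cluster_spectrum : exists mu : 'I_q -> R,
  [/\ forall x, `|x - nu^-1| < isolation_radius ->
         has_dim (form_eigenspace a m W x) #|[pred j | mu j == x]|,
      forall u, E u -> exists2 w, eigenfunction_span a m W mu w &
         N (u - w) <= (1 + L / r) * N (u - oproj a e u) &
      forall h, 0 <= h -> (forall u, E u -> N (u - oproj a e u) <= h * N u) ->
         forall j, `|nu^-1 - mu j| <= 8 / nu * h ^+ 2].
Proof.
pose g (j : 'I_q) : 'I_n := enum_val (cast_ord (esym cluster_card) j).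
have gI : injective g by move=> i j /enum_val_inj /cast_ord_inj.
have gB j : `|sig (g j) - nu| < r by exact: (enum_valP (cast_ord (esym cluster_card) j)).
have g_onto k : B k -> exists j, g j = k.
  move=> Bk; exists (cast_ord cluster_card (enum_rank_in Bk k)).
  by rewrite /g cast_ordK enum_rankK_in.
have sig_gt j : nu / 2 < sig (g j).
  by move: (gB j) r_nu; rewrite ltr_norml; lra.
have sig_gt0 j : 0 < sig (g j).
  by apply: lt_trans (sig_gt j); rewrite divr_gt0.
exists (fun j => (sig (g j))^-1); split.
- move=> x /inverse_near [x0 xr].
  (* Every [k] with [sig k = x^-1] lies in the cluster by [inverse_near], so counting within the
     cluster loses nothing. *)
  suff -> : #|[pred j | (sig (g j))^-1 == x]| = #|[pred k | sig k == x^-1]|.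
    exact: discrete_eigenspace_dim.
  rewrite -(fintype.card_image gI); apply: eq_card => k.
  apply/fintype.imageP/idP => [[j] /= /eqP <- ->|/= /eqP sk].
    by rewrite inE invrK.
  have [j jk] : exists j, g j = k by apply: g_onto; rewrite /= sk.
  by exists j => //; rewrite inE jk sk invrK.
- move=> u Eu; exists (\sum_(k | B k) a u (e k) *: e k); last exact: cluster_proj_le.
  apply: linear_span_sum => _ /g_onto [j <-]; apply: linear_span_incl; exists j => //; split.
    exact: e_in.
  by move=> v Wv; rewrite e_sig // mulrA mulVf ?mul1r // gt_eqF.
- move=> h h0 hE j; have := eigenvalue_rate (gB j) h0 hE.
  (* The rate [4 * nu * h ^+ 2] is divided by [nu * sig (g j)], and [sig (g j) > nu / 2] doubles the
     constant to 8. *)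
  have -> : nu^-1 - (sig (g j))^-1 = (sig (g j) - nu) / (nu * sig (g j)).
    by field; rewrite !gt_eqF.
  move=> le; rewrite normrM normfV (gtr0_norm (mulr_gt0 nu_gt0 (sig_gt0 j))).
  rewrite ler_pdivrMr ?mulr_gt0 //; apply: le_trans le _.
  have -> : 8 / nu * h ^+ 2 * (nu * sig (g j)) = 8 * h ^+ 2 * sig (g j).
    by field; rewrite gt_eqF.
  have := sqr_ge0 h; have := sig_gt j; nra.
Qed.

End DiscreteSpectrum.

(** * Consequences of compactness *)

Section Distance.
Context {R : realType} {V : normedModType R}.
Implicit Types (u w : V) (E W : set V).

Lemma dist_to_le u w W : W w -> dist_to u W <= `|u - w|.
Proof. by move=> Ww; apply: ge_inf; [exists 0 => _ [z _ <-]|exists w]. Qed.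

(** Nonemptiness of [W] matters: the infimum of the empty set is 0 by convention. *)
Lemma le_dist_to u W c : W !=set0 -> (forall w, W w -> c <= `|u - w|) ->
  c <= dist_to u W.
Proof.
move=> [w Ww] cW; apply: lb_le_inf; first by exists `|u - w|, w.
by move=> _ [z Wz <-]; exact: cW.
Qed.

Lemma dist_to_lt u W c : W !=set0 -> dist_to u W < c ->
  exists2 w, W w & `|u - w| < c.
Proof.
move=> W0 dc; apply: contrapT => nW; move: dc; apply/negP; rewrite -leNgt.
apply: le_dist_to => // w Ww; rewrite leNgt; apply/negP => uw.
by apply: nW; exists w.
Qed.

Lemma dist_to_le_gap E W u : W 0 -> E u -> `|u| = 1 -> dist_to u W <= gap E W.
Proof.
move=> W0 Eu u1; apply: ub_le_sup; last by exists u.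
by exists 1 => _ [z [_ z1] <-]; rewrite -z1 -[z in `|z|]subr0; exact: dist_to_le.
Qed.

Lemma gap_le E W c : (exists2 u, E u & `|u| = 1) ->
  (forall u, E u -> `|u| = 1 -> dist_to u W <= c) -> gap E W <= c.
Proof.
move=> [u Eu u1] Ec; apply: ge_sup; first by exists (dist_to u W), u.
by move=> _ [z [Ez z1] <-]; exact: Ec.
Qed.

End Distance.

(** * Uniform approximation and spectral gap of a compact solution operator *)

Section CompactSolutionOperator.
Context {R : realType} {V : normedModType R} (a m : {symmetric V}).
Context (M alpha K : R) (T : V -> V).
Hypothesis (M_gt0 : 0 < M) (alpha_gt0 : 0 < alpha) (K_ge0 : 0 <= K).
Hypothesis a_cont : forall w v, `|a w v| <= M * `|w| * `|v|.
Hypothesis a_coer : forall v, alpha * `|v| ^+ 2 <= a v v.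
Hypothesis m_cont : forall w v, `|m w v| <= K * `|w| * `|v|.
Hypothesis T_def : forall f v, a (T f) v = m f v.
Hypothesis T_compact : compact_operator T.
Implicit Types u v w : V.

Lemma coercive_form_gt0 v : v != 0 -> 0 < a v v.
Proof.
by move=> v0; apply: lt_le_trans (a_coer v); rewrite mulr_gt0 ?exprn_gt0 ?normr_gt0.
Qed.
Let a_gt0 := coercive_form_gt0.
Local Notation N := (enorm a).

Lemma enorm_le_norm v : N v <= Num.sqrt M * `|v|.
Proof.
rewrite -[`|v|]ger0_norm // -sqrtr_sqr -sqrtrM ?(ltW M_gt0) //; apply: ler_wsqrtr.
by have := le_trans (ler_norm _) (a_cont v v); rewrite -mulrA -expr2.
Qed.

Lemma norm_le_enorm v : Num.sqrt alpha * `|v| <= N v.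
Proof.
by rewrite -[`|v|]ger0_norm // -sqrtr_sqr -sqrtrM ?(ltW alpha_gt0) //; apply: ler_wsqrtr.
Qed.

Let sM_gt0 : 0 < Num.sqrt M. Proof. by rewrite sqrtr_gt0. Qed.
Let sal_gt0 : 0 < Num.sqrt alpha. Proof. by rewrite sqrtr_gt0. Qed.

Let TB := solution_operatorB a_gt0 T_def.
Let TZ := solution_operatorZ a_gt0 T_def.

(** Take [T v] as test vector: [N (T v) ^+ 2 = m v (T v)], then use continuity of [m] and
    coercivity, and cancel one factor [N (T v)]. *)
Lemma enorm_solution_operator v : N (T v) <= K / alpha * N v.
Proof.
have [->|Tv0] := eqVneq (T v) 0.
  by rewrite /enorm sform0l sqrtr0 mulr_ge0 ?sqrtr_ge0 // divr_ge0 // ltW.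
have NT : 0 < N (T v) by exact: enorm_gt0.
rewrite -(ler_pM2r NT) -expr2 enorm_sqr // T_def.
apply: le_trans (ler_norm _) _; apply: le_trans (m_cont _ _) _.
rewrite [leRHS](_ : _ = K * (alpha^-1 * N v * N (T v))); last by ring.
rewrite -mulrA ler_wpM2l // -mulrA ler_pdivlMl //.
rewrite -{1}[alpha]sqr_sqrtr ?(ltW alpha_gt0) // expr2 mulrACA.
by rewrite ler_pM ?mulr_ge0 ?norm_le_enorm // ltW.
Qed.

Lemma enorm_le1_bounded (A : set V) : (forall v, A v -> N v <= 1) -> bounded_set A.
Proof.
move=> A1; exists (Num.sqrt alpha)^-1; split; first exact: num_real.
move=> x xs v Av; apply: ltW; apply: le_lt_trans xs.
rewrite -(ler_pM2l sal_gt0) mulfV ?gt_eqF //.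
exact: le_trans (norm_le_enorm _) (A1 _ Av).
Qed.

(** The distances to [W i] tend to 0 pointwise; on the compact closure of the image of the energy
    unit ball this becomes uniform, and homogeneity extends it to all [v]. *)
Lemma solution_operator_approx (I : Type) (F : set_system I) (FF : ProperFilter F)
    (W : I -> set V) (eps : R) : 0 < eps ->
  (forall i, W i 0) -> (forall i c w, W i w -> W i (c *: w)) ->
  (forall v, dist_to v (W i) @[i --> F] --> (0 : R)) ->
  \forall i \near F, forall v, exists2 w, W i w & N (T v - w) <= eps * N v.
Proof.
move=> eps0 W0 WZ Wd; pose A := [set v | N v <= 1].
have /T_compact : bounded_set A by exact: enorm_le1_bounded.
rewrite precompactE => /compact_near_coveringP cover.
pose P i v := exists2 w, W i w & N (v - w) <= eps.
(* One half pays for approximating the centre [x], the other for moving from [x] to [x'];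
   [Num.sqrt M] converts to the energy norm. *)
have eta0 : 0 < eps / (2 * Num.sqrt M) by rewrite divr_gt0 // mulr_gt0.
have : \near F, closure (T @` A) `<=` P F.
  apply: cover => x _.
  have nearF : \forall i \near F, dist_to x (W i) < eps / (2 * Num.sqrt M).
    have /cvgrPdist_lt /(_ _ eta0) := Wd x; apply: filterS => i.
    by rewrite sub0r normrN; apply: le_lt_trans; exact: ler_norm.
  near=> x' i.
  have [||w Ww xw] := @dist_to_lt _ _ x (W i) (eps / (2 * Num.sqrt M)).
  - by exists 0.
  - by near: i.
  exists w => //; apply: le_trans (enorm_le_norm _) _.
  rewrite mulrC -ler_pdivlMr //.
  have xx' : `|x' - x| < eps / (2 * Num.sqrt M).
    near: x'; exact: cvgr_distC_lt.
  have := ler_distD x x' w; move: xx' xw.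
  have -> : eps / Num.sqrt M = eps / (2 * Num.sqrt M) + eps / (2 * Num.sqrt M).
    by field; rewrite gt_eqF.
  lra.
apply: filterS => i KP v; have [->|v0] := eqVneq v 0.
  exists 0 => //; rewrite subr0 -(scale0r (0 : V)) TZ !scale0r.
  by rewrite /enorm sform0l sqrtr0 mulr0.
have Nv : 0 < N v by exact: enorm_gt0.
have [|w Ww wle] := KP (T ((N v)^-1 *: v)).
  apply: subset_closure; exists ((N v)^-1 *: v) => //=.
  by rewrite /A /= enorm_normalize.
exists (N v *: w); first exact: WZ.
have -> : T v - N v *: w = N v *: (T ((N v)^-1 *: v) - w).
  by rewrite scalerBr TZ scalerA divff ?scale1r // gt_eqF.
by rewrite enormZ gtr0_norm // mulrC ler_wpM2r // ltW.
Unshelve. all: by end_near. Qed.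

(** Otherwise there are energy-unit vectors [u_ n] orthogonal to [E] with [T (u_ n) - nu *: u_ n]
    tending to 0. A cluster point [y] of [T (u_ n)] lies in [E] and is orthogonal to [E], hence is
    0, against [N (nu *: u_ n) = nu]. *)
Lemma solution_operator_gap (nu : R) q (f : 'I_q -> V) : 0 < nu ->
  orthofam a f -> (forall u, T u = nu *: u <-> linear_span (range f) u) ->
  exists2 delta, 0 < delta & forall v, (forall j, a v (f j) = 0) ->
    delta * N v <= N (T v - nu *: v).
Proof.
move=> nu0 of_ fE; apply: contrapT => nodelta.
have bad n : exists u, [/\ N u = 1, forall j, a u (f j) = 0 &
    N (T u - nu *: u) < n.+1%:R^-1].
  apply: contrapT => nou; apply: nodelta; exists n.+1%:R^-1; first by rewrite invr_gt0.
  move=> v vf; rewrite leNgt; apply/negP => lt.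
  have v0 : v != 0.
    apply: contraTneq lt => ->; rewrite -leNgt /enorm sform0l sqrtr0 mulr0.
    exact: enorm_ge0.
  have Nv : 0 < N v by exact: enorm_gt0.
  apply: nou; exists ((N v)^-1 *: v); split.
  - exact: enorm_normalize.
  - by move=> j; rewrite sformZl vf mulr0.
  - rewrite TZ scalerA [nu * _]mulrC -scalerA -scalerBr.
    by rewrite enormZ ger0_norm ?invr_ge0 ?ltW // ltr_pdivrMl // mulrC.
have [u_ uP] := choice bad.
have /T_compact : bounded_set (range u_).
  by apply: enorm_le1_bounded => _ [n _ <-]; have [->] := uP n.
rewrite precompactE => cK.
have inK : \forall n \near \oo, closure (T @` range u_) ((T \o u_) n).
  by apply: nearW => n; apply: subset_closure; exists (u_ n) => //; exists n.
have [y [_ yc]] := cK ((T \o u_) @ \oo) _ inK.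
have near_y eps : 0 < eps -> exists u, [/\ N u = 1, forall j, a u (f j) = 0,
    N (T u - nu *: u) < eps & N (T u - y) < eps].
  move=> eps0.
  have small : \forall n \near \oo,
      [set T (u_ k) | k in [set k | k.+1%:R^-1 < eps]] ((T \o u_) n).
    near=> n; exists n => //=.
    by near: n; exact: (near_infty_natSinv_lt (PosNum eps0)).
  have [_ [[n /= neps <-] yn]] := yc _ _ small
    (nbhsx_ballx y _ (divr_gt0 eps0 sM_gt0)).
  exists (u_ n); have [u1 uf ulim] := uP n; split => //.
    exact: lt_trans neps.
  apply: le_lt_trans (enorm_le_norm _) _.
  by rewrite mulrC -ltr_pdivlMr // distrC; move: yn; rewrite -ball_normE.
have L0 : 0 <= K / alpha by rewrite divr_ge0 // ltW.
have Ty : T y = nu *: y.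
  apply/eqP; rewrite -subr_eq0; apply/negPn/negP => /(enorm_gt0 a_gt0).
  set D := N _ => D0.
  (* Passing from [T y] to [nu *: y] through [T (T u)] and [nu *: T u] costs at most
     [(2 * (K / alpha) + nu) * eps]; the added 1 makes the inequality strict. *)
  have c0 : 0 < 2 * (K / alpha) + nu + 1 by move: L0 nu0; lra.
  have [u [_ _ u1 u2]] := near_y _ (divr_gt0 D0 c0).
  suff : D < D by rewrite ltxx.
  rewrite -{2}[D](divfK (lt0r_neq0 c0)).
  set eps := D / _ in u1 u2 *.
  have eps0 : 0 < eps by rewrite divr_gt0.
  apply: le_lt_trans (enormB_trans a_gt0 (T (T u)) _ _) _.
  rewrite -TB.
  have le1 := enorm_solution_operator (y - T u).
  have le2 : N (T (T u) - nu *: T u) <= K / alpha * N (T u - nu *: u).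
    by rewrite -TZ -TB; exact: enorm_solution_operator.
  have le3 : N (nu *: T u - nu *: y) = nu * N (T u - y).
    by rewrite -scalerBr enormZ gtr0_norm.
  have le4 := enormB_trans a_gt0 (nu *: T u) (T (T u)) (nu *: y).
  rewrite enormBC in le1.
  move: le1 le2 le3 le4 u1 u2; nra.
have Ey : linear_span (range f) y by apply/fE.
have y0 : y = 0.
  rewrite -(oproj_id of_ Ey); apply: big1 => j _.
  suff -> : a y (f j) = 0 by rewrite scale0r.
  apply/eqP/negPn/negP; rewrite -normr_gt0 => /near_y [u [_ uf _ uy]].
  move: uy; apply/negP; rewrite -leNgt.
  have Nf : N (f j) = 1 by rewrite /enorm of_ eqxx sqrtr1.
  (* [T] is symmetric for [a], so [T u] is orthogonal to [f j] together with [u]. *)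
  have <- : a (y - T u) (f j) = a y (f j).
    have Tf : T (f j) = nu *: f j by apply/fE; apply: linear_span_incl; exists j.
    rewrite sformBl T_def (sformC m) -T_def Tf sformZl (sformC a (f j)).
    by rewrite uf mulr0 subr0.
  apply: le_trans (enorm_CauchySchwarz a_gt0 _ _) _.
  by rewrite Nf mulr1 enormBC.
have nu2 : 0 < nu / 2 by rewrite divr_gt0.
have [u [Nu _ u1]] := near_y _ nu2; rewrite y0 subr0 => u2.
have := enormB_trans a_gt0 (T u) (nu *: u) 0.
rewrite !subr0 enormZ gtr0_norm // Nu mulr1 [N (nu *: u - _)]enormBC; lra.
Unshelve. all: by end_near. Qed.

Lemma enorm_oproj_le_dist n (e : 'I_n -> V) u : orthofam a e ->
  N (u - oproj a e u) <= Num.sqrt M * dist_to u (linear_span (range e)).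
Proof.
move=> oe; rewrite mulrC -ler_pdivrMr //; apply: le_dist_to.
  by exists 0; exact: linear_span0.
move=> w ew; rewrite ler_pdivrMr // mulrC.
by apply: le_trans (enorm_le_norm _); exact: oproj_best.
Qed.

(** Transfers the cluster estimates from the energy norm to the norm of [V], whose equivalence
    constants produce the powers of [M / alpha]. The last clause, with a free [h], serves to prove
    convergence along the filter. *)
Lemma discrete_cluster (nu delta eps : R) q (f : 'I_q -> V) n (v : 'I_n -> V)
    (E := linear_span (range f)) (W := linear_span (range v))
    (L := K / alpha) (r := gap_radius nu delta) :
  0 < nu -> 0 < delta -> orthofam a f -> (exists2 u, E u & u != 0) ->
  (forall u, E u -> T u = nu *: u) ->
  (forall v, (forall j, a v (f j) = 0) -> delta * N v <= N (T v - nu *: v)) ->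
  0 <= eps -> eps <= delta / 4 -> eps <= nu -> (1 + L / r) * eps < nu ->
  (forall u, exists2 w, W w & N (T u - w) <= eps * N u) ->
  exists mu : 'I_q -> R,
    [/\ forall x, `|x - nu^-1| < isolation_radius nu delta ->
           has_dim (form_eigenspace a m W x) #|[pred j | mu j == x]|,
        gap E (eigenfunction_span a m W mu) <=
          (1 + L / r) * Num.sqrt M / Num.sqrt alpha * gap E W,
        forall j, `|nu^-1 - mu j| <= 8 / nu * (M / alpha) * gap E W ^+ 2 &
        forall h, 0 <= h ->
          (forall u, E u -> exists2 w, W w & N (u - w) <= h * N u) ->
          forall j, `|nu^-1 - mu j| <= 8 / nu * h ^+ 2].
Proof.
move=> nu0 delta0 of_ [u0 Eu0 u0n0] TE T_gap eps0 eps_delta eps_nu eps_small TW.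
have [k [e [sig [oe eW em]]]] := simultaneous_diagonalization a_gt0 m v.
rewrite /W -eW in TW em *.
have L0 : 0 <= L by rewrite divr_ge0 // ltW.
have TP u : N (T u - oproj a e (T u)) <= eps * N u.
  by have [w Ww] := TW u; apply: le_trans; exact: oproj_best.
have [mu [muA muB muC]] := cluster_spectrum a_gt0 T_def enorm_solution_operator
  L0 nu0 delta0 of_ TE T_gap oe em TP eps0 eps_delta eps_nu eps_small.
have unit_E u : E u -> u != 0 -> E (`|u|^-1 *: u) /\ `| `|u|^-1 *: u| = 1.
  move=> Eu u0'; split; first exact: linear_spanZ.
  by rewrite normrZ normfV normr_id mulVf // normr_eq0.
have E1 : exists2 u, E u & `|u| = 1.
  by have [? ?] := unit_E _ Eu0 u0n0; exists (`|u0|^-1 *: u0).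
have gap_dist u : E u -> `|u| = 1 ->
    N (u - oproj a e u) <= Num.sqrt M * gap E (linear_span (range e)).
  move=> Eu u1; apply: le_trans (enorm_oproj_le_dist _ oe) _.
  by rewrite ler_pM2l // dist_to_le_gap //; exact: linear_span0.
have gap0 : 0 <= gap E (linear_span (range e)).
  have [u Eu u1] := E1; rewrite -(pmulr_rge0 _ sM_gt0).
  exact: le_trans (enorm_ge0 _ _) (gap_dist _ Eu u1).
exists mu; split => //.
- apply: gap_le => // u Eu u1; have [w Ww uw] := muB u Eu.
  apply: le_trans (dist_to_le _ Ww) _.
  rewrite -(ler_pM2l sal_gt0); apply: le_trans (norm_le_enorm _) _.
  apply: le_trans uw _.
  rewrite [leRHS](_ : _ = (1 + L / r) *
    (Num.sqrt M * gap E (linear_span (range e)))); last first.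
    by move: (1 + L / r) => X; field; rewrite gt_eqF.
  apply: ler_wpM2l; last exact: gap_dist.
  by rewrite addr_ge0 // divr_ge0 // ltW // gap_radius_gt0.
- move=> j; pose h := Num.sqrt M / Num.sqrt alpha * gap E (linear_span (range e)).
  have -> : 8 / nu * (M / alpha) * gap E (linear_span (range e)) ^+ 2 = 8 / nu * h ^+ 2.
    rewrite /h exprMn expr_div_n (sqr_sqrtr (ltW M_gt0)) (sqr_sqrtr (ltW alpha_gt0)).
    exact/esym/mulrA.
  apply: muC; first by rewrite mulr_ge0 // divr_ge0 // ltW.
  move=> u Eu; have [->|un0] := eqVneq u 0.
    by rewrite (oproj_id oe (linear_span0 _)) subr0 /enorm sform0l sqrtr0 mulr0.
  have [Eu' u1] := unit_E _ Eu un0.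
  have := gap_dist _ Eu' u1; rewrite oprojZ -scalerBr enormZ normfV normr_id.
  rewrite ler_pdivrMl ?normr_gt0 // => /le_trans; apply; rewrite /h.
  rewrite [leRHS](_ : _ = (N u / Num.sqrt alpha) *
    (Num.sqrt M * gap E (linear_span (range e)))); last by ring.
  rewrite ler_wpM2r ?mulr_ge0 ?sqrtr_ge0 // ler_pdivlMr // mulrC.
  exact: norm_le_enorm.
- move=> h h0 hE j; apply: muC => // u Eu.
  by have [w Ww] := hE u Eu; apply: le_trans; exact: oproj_best.
Qed.

End CompactSolutionOperator.

(** Richness is expressed along a proper filter [F]: the trial spaces come arbitrarily close to each
    fixed vector. [C] and [rho] are fixed beforehand, and the dimension count in the window of
    radius [rho] encodes that exactly [q] eigenvalues occur there, with multiplicity. *)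
Theorem theorem4p5 (R : realType) (V : completeNormedModType R)
    (ip : {dot V for idfun}) (ip_norm : forall x, `|x| ^+ 2 = ip x x)
    (a : {symmetric V}) (M alpha : R) (M_gt0 : 0 < M) (alpha_gt0 : 0 < alpha)
    (a_cont : forall w v, `|a w v| <= M * `|w| * `|v|)
    (a_coer : forall v, alpha * `|v| ^+ 2 <= a v v)
    (m : {symmetric V})
    (m_cont : exists K : R, forall w v, `|m w v| <= K * `|w| * `|v|)
    (m_ge0 : forall v, 0 <= m v v)
    (T : V -> V) (T_def : forall f v, a (T f) v = m f v)
    (T_compact : compact_operator T)
    (lam : R) (q : nat)
    (lam_eigen : form_eigenvalue a m setT lam)
    (lam_mult : has_dim (form_eigenspace a m setT lam) q) :
  exists C rho : R, 0 < C /\ 0 < rho /\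
  forall (Theta : Type) (phi : Theta -> V)
    (I : Type) (F : set_system I) (FF : ProperFilter F)
    (N : I -> nat) (theta : forall i, 'I_(N i) -> Theta),
  let E := form_eigenspace a m setT lam in
  let VRF i := rf_space phi (theta i) in
  (forall v, dist_to v (VRF i) @[i --> F] --> (0 : R)) ->
  exists lamRF : I -> 'I_q -> R,
    let ERF i := eigenfunction_span a m (VRF i) (lamRF i) in
    [/\ forall j, lamRF i j @[i --> F] --> lam,
        \forall i \near F, forall mu, `|mu - lam| < rho ->
          has_dim (form_eigenspace a m (VRF i) mu) #|[pred j | lamRF i j == mu]|,
        \forall i \near F, gap E (ERF i) <= C * gap E (VRF i) &
        \forall i \near F, \big[Num.max/0]_(j < q) `|lam - lamRF i j|
                             <= C * gap E (VRF i) ^+ 2].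
Proof.
set E := form_eigenspace a m setT lam.
have a_gt0 := coercive_form_gt0 alpha_gt0 a_coer.
have [u0 [_ u0E] u0n0] := lam_eigen.
have lam_gt0 : 0 < lam.
  have := a_gt0 _ u0n0; rewrite (u0E u0) // => lm.
  by have := m_ge0 u0; rewrite le_eqVlt => /orP [/eqP m0|m0];
    [rewrite -m0 mulr0 ltxx in lm|rewrite pmulr_lgt0 in lm].
have [K0 K0_m] := m_cont; pose K := Num.max K0 0.
have K_ge0 : 0 <= K by rewrite le_max lexx orbT.
have K_m w v : `|m w v| <= K * `|w| * `|v|.
  apply: le_trans (K0_m w v) _; rewrite -!mulrA ler_wpM2r ?mulr_ge0 //.
  by rewrite le_max lexx.
pose nu := lam^-1; have nu_gt0 : 0 < nu by rewrite invr_gt0.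
have T_E u : T u = nu *: u <-> E u.
  split=> [Tu|[_ uE]].
    by split=> // v _; rewrite -T_def Tu sformZl mulrA mulfV ?mul1r // gt_eqF.
  apply: (form_nondeg a_gt0) => v; rewrite T_def sformZl uE //.
  by rewrite mulrA mulVf ?mul1r // gt_eqF.
have [e0 [e0_indep e0_span]] := lam_mult.
have [q' [f [of_ f_span]]] := gram_schmidt a_gt0 e0.
have qq' : q' = q := linear_span_indep_eq (orthofam_indep of_) e0_indep f_span.
subst q'; rewrite -f_span -/E in e0_span.
have [delta delta_gt0 T_gap] : exists2 delta, 0 < delta &
    forall v, (forall j, a v (f j) = 0) ->
      delta * enorm a v <= enorm a (T v - nu *: v).
  apply: (solution_operator_gap M_gt0 alpha_gt0 K_ge0 a_cont a_coer K_m T_def) => //.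
  by move=> u; rewrite -e0_span.
pose L := K / alpha; pose r := gap_radius nu delta.
have r_gt0 : 0 < r by exact: gap_radius_gt0.
have Lr : 0 < 1 + L / r.
  by rewrite ltr_wpDr // !divr_ge0 // ltW.
pose C1 := (1 + L / r) * Num.sqrt M / Num.sqrt alpha.
pose C2 := 8 / nu * (M / alpha).
have C1_gt0 : 0 < C1 by rewrite divr_gt0 ?mulr_gt0 ?sqrtr_gt0.
have C2_gt0 : 0 < C2 by rewrite mulr_gt0 ?divr_gt0.
exists (C1 + C2), (isolation_radius nu delta); split; first exact: addr_gt0.
split; first by rewrite divr_gt0 // mulr_gt0 // exprn_gt0.
move=> Theta phi I F FF N theta /= VRF_dense.
set VRF := fun i => rf_space phi (theta i).
pose good i (mu : 'I_q -> R) :=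
  [/\ forall x, `|x - lam| < isolation_radius nu delta ->
        has_dim (form_eigenspace a m (VRF i) x) #|[pred j | mu j == x]|,
      gap E (eigenfunction_span a m (VRF i) mu) <= C1 * gap E (VRF i),
      forall j, `|lam - mu j| <= C2 * gap E (VRF i) ^+ 2 &
      forall h, 0 <= h -> (forall u, E u ->
          exists2 w, VRF i w & enorm a (u - w) <= h * enorm a u) ->
        forall j, `|lam - mu j| <= 8 / nu * h ^+ 2].
have approx eps : 0 < eps -> \forall i \near F, forall u,
    exists2 w, VRF i w & enorm a (T u - w) <= eps * enorm a u.
  move=> eps_gt0.
  apply: (solution_operator_approx M_gt0 alpha_gt0 a_cont a_coer T_def) => //.
    by move=> i; exact: linear_span0.
  by move=> i c w; exact: linear_spanZ.
have good_near : \forall i \near F, exists mu, good i mu.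
  (* The three terms yield [eps_delta], [eps_nu] and [eps_small]; the halved [nu] in the last one
     makes [eps_small] strict. *)
  pose eps := Num.min (delta / 4) (Num.min (nu / 2) (nu / 2 / (1 + L / r))).
  have eps_gt0 : 0 < eps by rewrite !lt_min !divr_gt0.
  apply: filterS (approx _ eps_gt0) => i VRF_T.
  rewrite /good -[lam]invrK -/nu e0_span.
  apply: (discrete_cluster M_gt0 alpha_gt0 K_ge0 a_cont a_coer K_m T_def) VRF_T => //.
  - by exists u0 => //; rewrite -e0_span.
  - by move=> u; rewrite -e0_span => /T_E.
  - exact: ltW.
  - by rewrite ge_min lexx.
  - have : eps <= nu / 2 by rewrite !ge_min lexx !orbT.
    by move: nu_gt0; lra.
  - have : eps <= nu / 2 / (1 + L / r) by rewrite !ge_min lexx !orbT.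
    by rewrite ler_pdivlMr // mulrC => le; apply: le_lt_trans le _; move: nu_gt0; lra.
have [lamRF lamRFP] : {lamRF : I -> 'I_q -> R &
    forall i, (exists mu, good i mu) -> good i (lamRF i)}.
  apply: (@choice _ _ (fun i mu => (exists mu, good i mu) -> good i mu)) => i.
  have [[mu ?]|no] := pselect (exists mu, good i mu); first by exists mu.
  (* A filler value: all claims about [lamRF] hold only eventually along [F]. *)
  by exists (fun=> lam).
have lamRF_near : \forall i \near F, good i (lamRF i) by exact: filterS good_near.
have E1 : exists2 u, E u & `|u| = 1.
  exists (`|u0|^-1 *: u0); last by rewrite normrZ normfV normr_id mulVf ?normr_eq0.
  by rewrite e0_span; apply: linear_spanZ; rewrite -e0_span.
have gap_ge0 i : 0 <= gap E (VRF i).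
  have [u Eu u1] := E1; apply: le_trans (dist_to_le_gap _ Eu u1); last first.
    exact: linear_span0.
  by apply: le_dist_to => //; exists 0; exact: linear_span0.
exists lamRF; split.
- move=> j; apply/cvgrPdist_lt => d d_gt0.
  (* With [h <= 1] the rate [8 / nu * h ^+ 2] is at most [8 / nu * h], hence at most [d / 2]. *)
  pose h := Num.min 1 (d / (16 / nu)).
  have h_gt0 : 0 < h by rewrite lt_min ltr01 !divr_gt0.
  have nuh : 0 < nu * h by exact: mulr_gt0.
  near=> i; have [_ _ _ rate] : good i (lamRF i) by near: i.
  have VRF_T : forall u, exists2 w, VRF i w & enorm a (T u - w) <= nu * h * enorm a u.
    by near: i; exact: approx.
  apply: le_lt_trans (rate h (ltW h_gt0) _ j) _.
    (* Since [T u = nu *: u], scaling an approximation of [T u] by [lam] approximates [u] and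
       divides the error [nu * h] by [nu]. *)
    move=> u /T_E Tu; have [w Ww uw] := VRF_T u.
    exists (lam *: w); first exact: linear_spanZ.
    rewrite -(ler_pM2l nu_gt0) -{1}[nu]gtr0_norm // -enormZ scalerBr scalerA.
    by rewrite mulVf ?gt_eqF // scale1r -Tu mulrA.
  have h1 : h <= 1 by rewrite ge_min lexx.
  have : h <= d / (16 / nu) by rewrite ge_min lexx orbT.
  rewrite ler_pdivlMr ?divr_gt0 // => hd.
  have nuV : 0 < nu^-1 by rewrite invr_gt0.
  apply: (@le_lt_trans _ _ (8 / nu * h)); last by move: hd; lra.
  by rewrite ler_pM2l ?divr_gt0 // expr2 ler_piMr // ltW.
- by apply: filterS lamRF_near => i [].
- apply: filterS lamRF_near => i [_ + _ _] => /le_trans; apply.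
  by rewrite ler_wpM2r // lerDl ltW.
- apply: filterS lamRF_near => i [_ _ rate _].
  have le : C2 * gap E (VRF i) ^+ 2 <= (C1 + C2) * gap E (VRF i) ^+ 2.
    by rewrite ler_wpM2r ?sqr_ge0 // lerDr ltW.
  apply: bigmax_le => [|j _]; last exact: le_trans (rate j) le.
  by rewrite mulr_ge0 ?sqr_ge0 // addr_ge0 ?ltW.
Unshelve. all: by end_near. Qed.
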